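(* $$\limsup_{t\to\infty}\frac1t\ln d_t\le \ln\lambda(L_0).$$
   Context: Let $N\in 4\mathbb{N}$, let $\mathcal{S}_N=\{0,\dots,N\}$, and let $J_0,J_N\in\{3,5,\dots,N-3\}$ (odd integers). Put $\nu_0=\delta_{J_0}$, $\nu_N=\delta_{J_N}$ (point masses). The transition function $p$ on $\mathcal{S}_N$ is $$p(x,y)=\begin{cases}\frac12 & x=y\\ \frac14 & |x-y|=1\\ \frac14\nu_x(y) & x\in\{0,N\},\ |y-x|>1\end{cases}$$ and $p(x,y)=0$ otherwise. (So from $0$ the chain jumps to $J_0$ with probability $\frac14$, and from $N$ it jumps to $J_N$ with probability $\frac14$.) For $x\in\mathcal{S}_N$, $P_x$ is the law under which $X=(X_n)_{n\in\mathbb{Z}_+}$ is a Markov chain with transition function $p$ and $X_0=x$. For $t\in\mathbb{Z}_+$ let $$d_t(x,y)=\max_{A\subset\mathcal{S}_N}\left(P_x(X_t\in A)-P_y(X_t\in A)\right),\qquad d_t=\sup_{x,y\in\mathcal{S}_N}d_t(x,y).$$ Define $$L_0=\tfrac12\max\{J_0-1,\;N-1-J_N,\;N+J_N-J_0\},\qquad \lambda(L)=\tfrac12\left(\cos\left(\frac{\pi}{L+1}\right)+1\right).$$ *)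

(* Defs.v *)
From HB Require Import structures.
From mathcomp Require Import all_boot all_order all_algebra.
From mathcomp Require Import all_classical all_reals all_analysis.

Set Implicit Arguments.
Unset Strict Implicit.
Unset Printing Implicit Defensive.

Import Order.TTheory GRing.Theory Num.Theory numFieldNormedType.Exports.

Local Open Scope classical_set_scope.
Local Open Scope ring_scope.

(* The redistribution law at the boundary point [x]: the point mass at [J0] if
   [x = 0], and at [JN] otherwise; it is only used for [x] in {0, N}. *)
Definition nu (R : realType) (N J0 JN : nat) (x y : 'I_N.+1) : R :=
  ((y : nat) == (if (x : nat) == 0%N then J0 else JN))%:R.

Definition trans (R : realType) (N J0 JN : nat) (x y : 'I_N.+1) : R :=
  if x == y then 2^-1
  else if `|(x : nat) - (y : nat)|%N == 1%N then 4^-1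
  else if ((x : nat) == 0%N) || ((x : nat) == N) then 4^-1 * nu R J0 JN x y
  else 0.

(* [X] is a Markov chain under [P], with transition function [p], started at
   [x]. Measurability of the finite-valued [X t] is that of its level sets. The
   Markov property P(X_{t+1} = s_{t+1} | X_0 = s_0, ..., X_t = s_t) =
   p(s_t, s_{t+1}) is multiplied out by P(X_0 = s_0, ..., X_t = s_t), so that
   nothing is required of null histories. *)
Definition markov_chain (R : realType) (S : finType) (p : S -> S -> R)
    (d : measure_display) (T : measurableType d) (P : probability T R)
    (X : nat -> T -> S) (x : S) : Prop :=
  [/\ forall t y, measurable (X t @^-1` [set y]),
      P (X 0%N @^-1` [set x]) = 1%E
    & forall (t : nat) (s : nat -> S),
        P [set w | forall i : nat, (i <= t.+1)%N -> X i w = s i] =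
        (P [set w | forall i : nat, (i <= t)%N -> X i w = s i] *
          (p (s t) (s t.+1))%:E)%E].

(* The total variation distance between the laws of [X t] under [P x] and
   [P y]. It is extended-real valued like measures; -oo is the neutral element
   of [maxe], and the family of all [A] is nonempty. *)
Definition tv_dist (R : realType) (S : finType)
    (d : measure_display) (T : measurableType d) (P : S -> probability T R)
    (X : nat -> T -> S) (t : nat) (x y : S) : \bar R :=
  (\big[maxe/-oo]_(A : {set S})
     (P x (X t @^-1` [set` A]) - P y (X t @^-1` [set` A])))%E.

Definition tv_sup (R : realType) (S : finType)
    (d : measure_display) (T : measurableType d) (P : S -> probability T R)
    (X : nat -> T -> S) (t : nat) : \bar R :=
  ereal_sup [set tv_dist P X t xy.1 xy.2 | xy in [set: S * S]].

Definition L0 (R : realType) (N J0 JN : nat) : R :=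
  2^-1 * Num.max (J0%:R - 1)
           (Num.max (N%:R - 1 - JN%:R) (N%:R + JN%:R - J0%:R)).

Definition lambda (R : realType) (L : R) : R :=
  2^-1 * (cos (pi / (L + 1)) + 1).

(* Main.v *)
Require Import Defs.
From HB Require Import structures.
From mathcomp Require Import all_boot all_order all_algebra.
From mathcomp Require Import all_classical all_reals all_analysis.
From mathcomp Require Import zify ring lra.

Set Implicit Arguments.
Unset Strict Implicit.
Unset Printing Implicit Defensive.

Import Order.TTheory GRing.Theory Num.Theory numFieldNormedType.Exports.

Local Open Scope classical_set_scope.
Local Open Scope ring_scope.

(** The idea is to write an eigenvalue of [p] as [(cos th + 1) / 2] and to see
    that [th] can be taken real, and either [0] or at least [pi / (L0 + 1)].
    The proof below does this without eigenvectors, so that no multiplicity has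
    to be discussed.

    Fix a set [A] and let [u_t = p^t 1_A], so that [P_x(X_t \in A) = u_t x]
    ([law_markov_op]). Give [u_t] the additional values [u_t (-1) = u_t J0] and
    [u_t (N+1) = u_t JN]: then [u] solves the lazy heat equation
    [u_{t+1} x = u_t x / 2 + (u_t (x-1) + u_t (x+1)) / 4] at all points of
    [0..N], the two boundary points included ([markov_op_trans]). By parity,
    the midpoint [m0] of [-1] and [J0] and the midpoint [m1] of [JN] and [N+1]
    are integers, and three functions solve the heat equation with Dirichlet
    boundary values:
    - the odd part of [u] about [m0], on [m0..J0], of length [(J0 + 1) / 2];
    - the odd part of [u] about [m1], on [m1..N+1], of length
      [(N + 1 - JN) / 2];
    - the discrete derivative [u (x+1) - u (x-1)], on [m0..m1], of length
      [(N + JN - J0 + 2) / 2]. Its values at [m0] and [m1] are those of the odd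
      parts at distance [1] from the centers, which are already controlled.

    The largest of the three lengths is [L0 + 1]. On an interval of length [l],
    a solution with boundary values [O(r^t)], [r = (cos th + 1) / 2] and
    [th l < pi], is [O(r^t)] itself, by comparison with a cosine of frequency
    [th] that is positive on the closed interval ([dirichlet_decays]). Hence,
    for each [th < pi / (L0 + 1)], the odd parts and then the derivative are
    [O(r^t)]. Reflections about [m0] and [m1], which are symmetries of [u] up to
    the odd parts, carry the bound on the derivative to all of [0..N], and one
    step of the heat equation turns differences over distance two into
    differences over distance one. So [u_t x - u_t y = O(r^t)]
    ([reflected_heat_decays]), which bounds the limsup by [ln r]
    ([limn_esup_lne_le]); finally [th] tends to [pi / (L0 + 1)]. *)

(** * Geometrically decaying sequences *)

Definition decays (R : realType) (r : R) (a : nat -> R) :=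
  exists C, forall t, `|a t| <= C * r ^+ t.

Lemma eq_decays (R : realType) (r : R) (a b : nat -> R) :
  a =1 b -> decays r a -> decays r b.
Proof. by move=> ab [C aC]; exists C => t; rewrite -ab. Qed.

Lemma decays0 (R : realType) (r : R) : decays r (fun=> 0).
Proof. by exists 0 => t; rewrite normr0 mul0r. Qed.

Lemma decaysD (R : realType) (r : R) (a b : nat -> R) :
  decays r a -> decays r b -> decays r (fun t => a t + b t).
Proof.
move=> [C aC] [D bD]; exists (C + D) => t.
by rewrite mulrDl (le_trans (ler_normD _ _))// lerD.
Qed.

Lemma decaysZ (R : realType) (r c : R) (a : nat -> R) :
  decays r a -> decays r (fun t => c * a t).
Proof.
by move=> [C aC]; exists (`|c| * C) => t; rewrite normrM -mulrA ler_wpM2l.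
Qed.

Lemma decaysB (R : realType) (r : R) (a b : nat -> R) :
  decays r a -> decays r b -> decays r (fun t => a t - b t).
Proof.
move=> da db; apply: eq_decays (decaysD da (decaysZ (-1) db)) => t.
by rewrite mulN1r.
Qed.

Lemma decays_shift (R : realType) (r : R) (a : nat -> R) :
  0 < r -> decays r (fun t => a t.+1) -> decays r a.
Proof.
move=> r0 [C aC]; exists (`|a 0%N| + C / r) => -[|t].
  rewrite expr0 mulr1 lerDl divr_ge0// ?(ltW r0)//.
  by have := le_trans (normr_ge0 _) (aC 0%N); rewrite expr0 mulr1.
have Cr : C / r * r ^+ t.+1 = C * r ^+ t by rewrite exprS mulrA divfK ?gt_eqF.
by rewrite mulrDl Cr (le_trans (aC t))// lerDr mulr_ge0// exprn_ge0// ltW.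
Qed.

(** * The lazy heat equation on an interval *)

(** The value at [0] of [i.-1] makes this meaningful for [0 < i] only. *)
Definition heat (R : realType) (w : nat -> nat -> R) (i : nat) :=
  forall t, w t.+1 i = 2^-1 * w t i + 4^-1 * (w t i.-1 + w t i.+1).

(** The eigenvalue of the lazy heat operator on waves of frequency [th]; the
    function [lambda] of the statement is [L |-> rate (pi / (L + 1))]. *)
Definition rate (R : realType) (th : R) : R := 2^-1 * (cos th + 1).

Lemma rate_ge0 (R : realType) (th : R) : 0 <= rate th.
Proof. by rewrite /rate; have := cos_geN1 th; lra. Qed.

Lemma rate_gt0 (R : realType) (th : R) : 0 < th < pi -> 0 < rate th.
Proof.
move=> /andP[th0 thpi]; rewrite /rate.
have : cos pi < cos th by rewrite ltr_cos// in_itv/=; apply/andP; lra.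
by rewrite cospi; lra.
Qed.

(** The wave [phi i = cos (th * (i - l / 2))] is multiplied by [rate th] by the
    heat operator, and it is positive on all of [0..l], endpoints included,
    because [th * l < pi]. A large multiple of [rate th ^+ t * phi i] dominates
    [|w|] initially and on the boundary, hence everywhere by positivity of the
    heat operator. *)
Lemma dirichlet_decays (R : realType) (th : R) (l : nat) (w : nat -> nat -> R) :
  0 < th -> th * l%:R < pi ->
  (forall i, (0 < i < l)%N -> heat w i) ->
  decays (rate th) (w^~ 0%N) -> decays (rate th) (w^~ l) ->
  forall i, (i <= l)%N -> decays (rate th) (w^~ i).
Proof.
move=> th0 thl hw [C0 w0C] [C1 wlC].
pose phi i : R := cos (th * (i%:R - l%:R / 2)).
have phi_gt0 i : (i <= l)%N -> 0 < phi i.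
  move=> il; have i0 : 0 <= i%:R :> R by [].
  have {}il : i%:R <= l%:R :> R by rewrite ler_nat.
  apply: cos_gt0_pihalf; apply/andP; split.
    have : 0 <= th * i%:R by rewrite mulr_ge0// ltW.
    by lra.
  have : th * i%:R <= th * l%:R by rewrite ler_wpM2l// ltW.
  by lra.
have r0 := rate_ge0 th.
have ge0 t i : (i <= l)%N -> 0 <= rate th ^+ t * phi i.
  by move=> il; rewrite mulr_ge0 ?exprn_ge0// ltW// phi_gt0.
have C0_ge0 : 0 <= C0.
  by have := le_trans (normr_ge0 _) (w0C 0%N); rewrite expr0 mulr1.
have C1_ge0 : 0 <= C1.
  by have := le_trans (normr_ge0 _) (wlC 0%N); rewrite expr0 mulr1.
pose S := \sum_(i < l.+1) `|w 0%N i| / phi i.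
have S_ge0 : 0 <= S.
  by apply: sumr_ge0 => i _; rewrite divr_ge0// ltW// phi_gt0// -ltnS.
pose K := C0 / phi 0%N + C1 / phi l + S.
have A0 : 0 <= C0 / phi 0%N by rewrite divr_ge0// ltW// phi_gt0.
have A1 : 0 <= C1 / phi l by rewrite divr_ge0// ltW// phi_gt0.
have phiE i : (0 < i)%N -> 2^-1 * phi i + 4^-1 * (phi i.-1 + phi i.+1)
    = rate th * phi i.
  case: i => // i _; rewrite /phi /rate /=.
  have -> : th * (i%:R - l%:R / 2) = th * (i.+1%:R - l%:R / 2) - th.
    by rewrite -natr1; ring.
  have -> : th * (i.+2%:R - l%:R / 2) = th * (i.+1%:R - l%:R / 2) + th.
    by rewrite -(natr1 i.+1); ring.
  by rewrite cosB cosD; field.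
have bound t : forall i, (i <= l)%N -> `|w t i| <= K * (rate th ^+ t * phi i).
  have bd0 s : `|w s 0%N| <= K * (rate th ^+ s * phi 0%N).
    apply: (le_trans (w0C s)); rewrite mulrCA mulrC ler_wpM2l ?exprn_ge0//.
    by rewrite -ler_pdivrMr ?phi_gt0//; rewrite /K; lra.
  have bdl s : `|w s l| <= K * (rate th ^+ s * phi l).
    apply: (le_trans (wlC s)); rewrite mulrCA mulrC ler_wpM2l ?exprn_ge0//.
    by rewrite -ler_pdivrMr ?phi_gt0//; rewrite /K; lra.
  elim: t => [|t IH] i il.
    rewrite expr0 mul1r -ler_pdivrMr ?phi_gt0//.
    suff : `|w 0%N i| / phi i <= S by rewrite /K; lra.
    have il' : (i < l.+1)%N by rewrite ltnS.
    rewrite /S (bigD1 (Ordinal il'))//= lerDl; apply: sumr_ge0 => j _.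
    by rewrite divr_ge0// ltW// phi_gt0// -ltnS.
  have [->|i0] := posnP i; first exact: bd0.
  have [->|nil] := eqVneq i l; first exact: bdl.
  have {}nil : (i < l)%N by rewrite ltn_neqAle nil.
  rewrite hw ?i0// exprSr -mulrA -phiE//.
  have h1 := IH i il.
  have h2 := IH i.+1 nil.
  have h3 : `|w t i.-1| <= K * (rate th ^+ t * phi i.-1).
    by apply: IH; rewrite (leq_trans (leq_pred _)).
  move: h1 h2 h3; rewrite !ler_norml => /andP[? ?] /andP[? ?] /andP[? ?].
  by apply/andP; split; lra.
move=> i il; exists (K * phi i) => t.
by rewrite -mulrA (mulrC (phi i)) bound.
Qed.

(** * Reflecting boundary conditions *)

(** The conditions at [0] and [M] say that the odd parts of [U] about [a] and
    about [b] vanish there. The frequencies [th] allowed are those below the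
    lowest one of each of the three Dirichlet problems, on [[0, a]], [[b, M]]
    (for the odd parts) and [[a, b]] (for the discrete derivative). *)
Lemma reflected_heat_decays (R : realType) (th : R) (M a b : nat)
    (U : nat -> nat -> R) :
  0 < th < pi ->
  (0 < a < b)%N -> (b < M <= b.*2)%N -> (a.*2 <= M)%N ->
  th * a%:R < pi -> th * (M - b)%:R < pi -> th * (b - a)%:R < pi ->
  (forall i, (0 < i < M)%N -> heat U i) ->
  (forall t, U t 0%N = U t a.*2) -> (forall t, U t M = U t (b.*2 - M)%N) ->
  forall i j, (0 < i < M)%N -> (0 < j < M)%N ->
    decays (rate th) (fun t => U t i - U t j).
Proof.
move=> thpi /andP[a0 ab] /andP[bM Mb] aM tha thb thab hU U0 UM.
have th0 : 0 < th by case/andP: thpi.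
set r := rate th; have r0 : 0 < r by exact: rate_gt0.
have ga k : (k <= a)%N -> decays r (fun t => U t (a + k)%N - U t (a - k)%N).
  apply: (dirichlet_decays (w := fun t k => U t (a + k)%N - U t (a - k)%N)) => //.
  - move=> [|i]// /andP[_ ia] t /=; rewrite !hU; try lia.
    have -> : (a + i.+1).-1 = (a + i)%N by lia.
    have -> : (a + i.+1).+1 = (a + i.+2)%N by lia.
    have -> : (a - i.+1).-1 = (a - i.+2)%N by lia.
    have -> : (a - i.+1).+1 = (a - i)%N by lia.
    by ring.
  - by apply: eq_decays (decays0 r) => t; rewrite addn0 subn0 subrr.
  - by apply: eq_decays (decays0 r) => t; rewrite subnn U0 addnn subrr.
have gb k : (k <= M - b)%N -> decays r (fun t => U t (b + k)%N - U t (b - k)%N).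
  apply: (dirichlet_decays (w := fun t k => U t (b + k)%N - U t (b - k)%N)) => //.
  - move=> [|i]// /andP[_ ib] t /=; rewrite !hU; try lia.
    have -> : (b + i.+1).-1 = (b + i)%N by lia.
    have -> : (b + i.+1).+1 = (b + i.+2)%N by lia.
    have -> : (b - i.+1).-1 = (b - i.+2)%N by lia.
    have -> : (b - i.+1).+1 = (b - i)%N by lia.
    by ring.
  - by apply: eq_decays (decays0 r) => t; rewrite addn0 subn0 subrr.
  - apply: eq_decays (decays0 r) => t.
    have -> : (b + (M - b))%N = M by lia.
    have -> : (b - (M - b))%N = (b.*2 - M)%N by lia.
    by rewrite UM subrr.
(* The centered difference; at [a] and [b] it is an odd part at distance 1. *)
pose v t i : R := U t i.+1 - U t i.-1.
have hv i : (1 < i)%N -> (i.+1 < M)%N -> heat v i.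
  by move: i => [|[|i]]// _ iM t; rewrite /v /= !hU; try lia; rewrite /=; ring.
have vab i : (a <= i <= b)%N -> decays r (v^~ i).
  move=> /andP[ai ib].
  have : (i - a <= b - a)%N by lia.
  have := @dirichlet_decays R th (b - a) (fun t k => v t (a + k)%N) th0 thab.
  move=> /[apply]; rewrite -/r; (have -> : (a + (i - a))%N = i by lia); apply.
  - by move=> [|j]// jba t; rewrite !addnS/= hv//=; lia.
  - apply: eq_decays (ga 1%N _) => [t|]; last lia.
    by rewrite /v addn0 addn1 subn1.
  - apply: eq_decays (gb 1%N _) => [t|]; last lia.
    rewrite /v; have -> : (a + (b - a))%N = b by lia.
    by rewrite addn1 subn1.
(* The reflections about [a] and [b] reverse [v] up to the odd parts. *)
have va i : (0 < i < a)%N -> decays r (v^~ (a.*2 - i)%N) -> decays r (v^~ i).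
  move=> ia dv.
  apply: eq_decays (decaysB (decaysB (ga (a - i).+1 _) (ga (a - i).-1 _)) dv);
    try lia.
  move=> t; rewrite /v.
  have -> : (a + (a - i).+1)%N = (a.*2 - i).+1 by lia.
  have -> : (a - (a - i).+1)%N = i.-1 by lia.
  have -> : (a + (a - i).-1)%N = (a.*2 - i).-1 by lia.
  have -> : (a - (a - i).-1)%N = i.+1 by lia.
  by ring.
have vb i : (b < i < M)%N -> decays r (v^~ (b.*2 - i)%N) -> decays r (v^~ i).
  move=> ib dv.
  apply: eq_decays (decaysB (decaysB (gb (i - b).+1 _) (gb (i - b).-1 _)) dv);
    try lia.
  move=> t; rewrite /v.
  have -> : (b + (i - b).+1)%N = i.+1 by lia.
  have -> : (b - (i - b).+1)%N = (b.*2 - i).-1 by lia.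
  have -> : (b + (i - b).-1)%N = i.-1 by lia.
  have -> : (b - (i - b).-1)%N = (b.*2 - i).+1 by lia.
  by ring.
have vall i : (0 < i < M)%N -> decays r (v^~ i).
  (* Each reflection brings a point strictly closer to [[a, b]]; the image may
     fall beyond the other center, whence the induction. *)
  have [n] := ubnP ((a - i) + (i - b))%N; elim: n i => // n IH i ni iM.
  have [ia|ai] := ltnP i a; first by apply: va; [lia|apply: IH; lia].
  have [bi|ib] := ltnP b i; first by apply: vb; [lia|apply: IH; lia].
  by apply: vab; lia.
(* One time step expresses [U (i+1) - U i] by [v], whatever the parities. *)
have dS i : (0 < i)%N -> (i.+1 < M)%N -> decays r (fun t => U t i.+1 - U t i).
  move=> i0 iM; apply: decays_shift => //.
  apply: eq_decays (decaysZ 4^-1 (decaysD (vall i _) (vall i.+1 _))); try lia.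
  by move=> t; rewrite !hU; try lia; rewrite /v /=; field.
have d1 i : (0 < i < M)%N -> decays r (fun t => U t i - U t 1%N).
  elim: i => // -[_ _|i IH iM].
    by apply: eq_decays (decays0 r) => t; rewrite subrr.
  apply: eq_decays (decaysD (dS i.+1 _ _) (IH _)); try lia.
  by move=> t; ring.
move=> i j iM jM; apply: eq_decays (decaysB (d1 i iM) (d1 j jM)) => t.
by ring.
Qed.

(** * Laws of a finite Markov chain *)

Definition markov_op (R : realType) (S : finType) (p : S -> S -> R)
    (f : S -> R) (x : S) : R :=
  \sum_y p x y * f y.

Lemma measurable_preimage_fset (S : finType) (d : measure_display)
    (T : measurableType d) (Y : T -> S) (B : {set S}) :
  (forall y, measurable (Y @^-1` [set y])) -> measurable (Y @^-1` [set` B]).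
Proof.
move=> mY.
have -> : Y @^-1` [set` B] = \bigcup_(y in [set` B]) Y @^-1` [set y].
  apply/seteqP; split=> [w Bw|w [y By Xy]]; first by exists (Y w).
  by rewrite /= Xy.
by apply: fin_bigcup_measurable => //; exact: finite_finset.
Qed.

(** Conditioning on a whole history is what allows an induction on [k]: the
    next state [y] is added to the history, at the cost of a sum over the
    finite state space only. *)
Lemma path_markov_op (R : realType) (S : finType) (p : S -> S -> R)
    (d : measure_display) (T : measurableType d) (P : probability T R)
    (X : nat -> T -> S) (x : S) (k n : nat) (s : nat -> S) (B : {set S}) :
  markov_chain p P X x ->
  P ([set w | forall i, (i <= n)%N -> X i w = s i] `&` X (n + k)%N @^-1` [set` B])
  = (P [set w | forall i, (i <= n)%N -> X i w = s i] *
     (iter k (markov_op p) (fun y => (y \in B)%:R) (s n))%:E)%E.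
Proof.
pose path n (s : nat -> S) := [set w | forall i : nat, (i <= n)%N -> X i w = s i].
rewrite -/(path n s) => -[mX1 _ XM].
have mX t : measurable (X t @^-1` [set` B]) by exact: measurable_preimage_fset.
have mpath m u : measurable (path m u).
  have -> : path m u = \bigcap_(i in `I_m.+1) X i @^-1` [set u i].
    by apply/seteqP; split=> w h i /=; [rewrite ltnS => /h|rewrite -ltnS => /h].
  by apply: fin_bigcap_measurable => //; exact: finite_II.
elim: k n s => [|k IH] n s.
  rewrite addn0/=.
  case: (boolP (s n \in B)) => snB.
    rewrite mule1; congr (P _); apply/seteqP; split=> [w []//|w pw].
    by split=> //=; rewrite pw.
  rewrite mule0 -[RHS](measure0 P); congr (P _).
  by apply/seteqP; split=> w //= -[/(_ n (leqnn _)) -> ]; exact/negP.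
(* The history [s] up to time [n], followed by [y]. *)
pose ext y i := if (i <= n)%N then s i else y.
have extE y : path n.+1 (ext y) = path n s `&` X n.+1 @^-1` [set y].
  apply/seteqP; split=> [w h|w [h /= Xy] i].
    split=> [i ni|]; first by rewrite h ?(leqW ni)// /ext ni.
    by rewrite /= h// /ext ltnn.
  rewrite leq_eqVlt ltnS /ext => /orP[/eqP->|ni]; first by rewrite ltnn.
  by rewrite ni h.
have -> : path n s `&` X (n + k.+1)%N @^-1` [set` B] =
    \bigcup_(y in [set: S]) (path n.+1 (ext y) `&` X (n.+1 + k)%N @^-1` [set` B]).
  rewrite addSnnS; apply/seteqP; split=> [w [h XB]|w [y _]].
    by exists (X n.+1 w) => //; rewrite extE.
  by rewrite extE => -[[]].
rewrite measure_fin_bigcup//=; last 2 first.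
- move=> y z _ _ [w []]; rewrite !extE => -[[_ /= <-] _] [[_ /= <-] _]//.
- by move=> y _; exact: measurableI.
have -> : [set: S] = [set` index_enum S].
  by apply/seteqP; split=> y //= _; rewrite mem_index_enum.
rewrite -(fsbig_seq _ _ (index_enum_uniq S)).
under eq_bigr => y _.
  rewrite IH XM.
  have -> : [set w | forall i, (i <= n)%N -> X i w = ext y i] = path n s.
    by apply/seteqP; split=> w h i ni; rewrite h// /ext ni.
  rewrite /ext leqnn ltnn -muleA; over.
have /fineK <- : P (path n s) \is a fin_num by exact: fin_num_measure.
rewrite -EFinM mulr_sumr -sumEFin.
by apply: eq_bigr => y _; rewrite -!EFinM.
Qed.

Lemma law_markov_op (R : realType) (S : finType) (p : S -> S -> R)
    (d : measure_display) (T : measurableType d) (P : probability T R)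
    (X : nat -> T -> S) (x : S) (t : nat) (B : {set S}) :
  markov_chain p P X x ->
  P (X t @^-1` [set` B]) =
  (iter t (markov_op p) (fun y => (y \in B)%:R) x)%:E.
Proof.
move=> XM; have [mX1 PX0 _] := XM.
have := path_markov_op t 0 (fun=> x) B XM; rewrite add0n.
have -> : [set w | forall i, (i <= 0)%N -> X i w = x] = X 0%N @^-1` [set x].
  apply/seteqP; split=> [w /(_ 0%N (leqnn _))//|w /= Xx i].
  by rewrite leqn0 => /eqP ->.
rewrite PX0 mul1e => <-.
have mX : measurable (X t @^-1` [set` B]) by exact: measurable_preimage_fset.
rewrite [LHS](measureDI P mX (mX1 0%N x)) setIC -[RHS]add0e; congr (_ + _)%E.
apply/eqP; rewrite -measure_le0.
have <- : P (~` (X 0%N @^-1` [set x])) = 0%E.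
  by rewrite probability_setC// PX0 subee.
apply: le_measure; rewrite ?inE; [exact: measurableD|exact: measurableC|].
by move=> w [].
Qed.

(** * Exponential rates and limsup *)

Lemma limn_esup_le (R : realType) (u v : nat -> \bar R) :
  (forall t, (0 < t)%N -> (u t <= v t)%E) -> (limn_esup u <= limn_esup v)%E.
Proof.
move=> uv; rewrite !limn_esup_lim.
apply: lee_lim; [exact: is_cvg_esups|exact: is_cvg_esups|].
exists 1%N => // n /= n1; apply: ub_ereal_sup => _ [m /= nm <-].
apply: (le_trans (uv _ (leq_trans n1 nm))).
by apply: ereal_sup_ubound; exists m.
Qed.

(** The prefactor [C] is invisible at the exponential scale: [ln C / t -> 0]. *)
Lemma limn_esup_lne_le (R : realType) (r C : R) (e : nat -> \bar R) :
  0 < r -> (forall t, (e t <= (C * r ^+ t)%:E)%E) ->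
  (limn_esup (fun t => (t%:R^-1)%:E * lne (e t)) <= (ln r)%:E)%E.
Proof.
move=> r0 eC.
(* A positive prefactor, so that its logarithm makes sense. *)
pose K := Num.max C 1.
have K0 : 0 < K by rewrite lt_max ltr01 orbT.
have eK t : (e t <= (K * r ^+ t)%:E)%E.
  apply: (le_trans (eC t)); rewrite lee_fin ler_wpM2r ?exprn_ge0 ?(ltW r0)//.
  by rewrite le_max lexx.
have lim : ((ln K / t%:R + ln r)%:E @[t --> \oo] --> (ln r)%:E).
  apply: cvg_EFin; first by near=> t.
  rewrite -[X in _ --> X]add0r; apply: cvgD; last exact: cvg_cst.
  rewrite -[X in _ --> X](mulr0 (ln K)); apply: cvgMr.
  rewrite -(cvg_shiftS (fun t => t%:R^-1 : R)). exact: cvg_harmonic.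
rewrite -(cvg_limn_einf_sup lim).2; apply: limn_esup_le => t t0.
have t0' : 0 < t%:R :> R by rewrite ltr0n.
have -> : (ln K / t%:R + ln r)%:E = ((t%:R^-1)%:E * (ln (K * r ^+ t))%:E)%E.
  rewrite -EFinM lnM ?posrE ?exprn_gt0// lnXn// -mulr_natl; congr _%:E.
  by field; rewrite gt_eqF.
rewrite -lne_EFin ?mulr_gt0 ?exprn_gt0//.
rewrite lee_pmul2l ?lte_fin ?invr_gt0//.
have [e0|e0] := leP (e t) 0%E; first by rewrite le0_lneNy// leNye.
rewrite lee_lne// in_itv/= ?leey ?andbT; first exact: ltW.
by rewrite lee_fin mulr_ge0 ?exprn_ge0 ?(ltW r0) ?(ltW K0).
Unshelve. all: end_near.
Qed.

(** * The redistributed walk *)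

(** The function [f] on [-1..N+1], with [-1] identified with [J0] and [N+1] with
    [JN]; the index [i] stands for the point [i - 1]. *)
Definition extend (R : realType) (N J0 JN : nat) (f : 'I_N.+1 -> R) (i : nat) : R :=
  f (inord (if i == 0%N then J0 else if i == N.+2 then JN else i.-1)).

(** A jump from [0] to [J0] is a step to the additional point [-1], and likewise
    at [N]. So [trans x] is the lazy nearest neighbour law at every [x], with the
    left and right neighbours [l] and [r] below. *)
Lemma markov_op_trans (R : realType) (N J0 JN : nat) (f : 'I_N.+1 -> R)
    (x : 'I_N.+1) :
  (2 <= J0 <= N)%N -> (JN + 2 <= N)%N ->
  markov_op (@trans R N J0 JN) f x =
  2^-1 * f x + 4^-1 * (extend J0 JN f x + extend J0 JN f x.+2).
Proof.
move=> J0N JNN.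
pose l : 'I_N.+1 := inord (if (x : nat) == 0%N then J0 else x.-1).
pose r : 'I_N.+1 := inord (if (x : nat) == N then JN else x.+1).
have xN := ltn_ord x.
have lE : l = (if (x : nat) == 0%N then J0 else x.-1) :> nat.
  by rewrite inordK//; case: eqP => _; lia.
have rE : r = (if (x : nat) == N then JN else x.+1) :> nat.
  by rewrite inordK//; case: eqP => ?; lia.
have transE y : @trans R N J0 JN x y =
    2^-1 * (y == x)%:R + 4^-1 * (y == l)%:R + 4^-1 * (y == r)%:R.
  rewrite /trans /nu -!val_eqE /= lE rE {l r lE rE}.
  have yN := ltn_ord y.
  move: (x : nat) (y : nat) xN yN => {}x {}y xN yN.
  have [x0|x0] := eqVneq x 0%N; have [xeN|xeN] := eqVneq x N;
    rewrite /=; try (by exfalso; lia);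
    repeat (case: eqP => ? /=; try (by exfalso; lia)); rewrite ?mulr0 ?mulr1; lra.
have sumE z : \sum_y (y == z)%:R * f y = f z.
  rewrite (bigD1 z)//= eqxx mul1r big1 ?addr0// => y /negbTE ->.
  by rewrite mul0r.
rewrite /markov_op; under eq_bigr => y _ do rewrite transE !mulrDl -!mulrA.
rewrite !big_split/= -!mulr_sumr !sumE.
have -> : extend J0 JN f x = f l.
  rewrite /extend; congr f; congr inord; case: eqP => // _; case: eqP => //; lia.
have -> : extend J0 JN f x.+2 = f r.
  by rewrite /extend /= !eqSS.
by ring.
Qed.

(** [reflected_heat_decays] applies with [M = N + 2] and with the shifted
    midpoints [a = (J0 + 1) / 2] and [b = (N + JN + 3) / 2], integers by parity;
    the terms of the maximum defining [L0] are [2 * a - 2], [2 * (M - b) - 2] and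
    [2 * (b - a) - 2]. *)
Lemma markov_op_trans_decays (R : realType) (N J0 JN : nat) (th : R)
    (f : 'I_N.+1 -> R) (x y : 'I_N.+1) :
  ~~ odd N -> odd J0 -> (3 <= J0)%N -> (J0 + 3 <= N)%N ->
  odd JN -> (3 <= JN)%N -> (JN + 3 <= N)%N ->
  0 < th < pi / (L0 R N J0 JN + 1) ->
  decays (rate th) (fun t => iter t (markov_op (@trans R N J0 JN)) f x -
                             iter t (markov_op (@trans R N J0 JN)) f y).
Proof.
move=> oN oJ0 J03 J0N oJN JN3 JNN /andP[th0 thL].
pose F t := iter t (markov_op (@trans R N J0 JN)) f.
pose U t := extend J0 JN (F t).
have UE t (z : 'I_N.+1) : U t z.+1 = F t z.
  by rewrite /U /extend /= eqSS ltn_eqF ?ltn_ord// inord_val.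
pose a := (J0.+1)./2; pose b := (N + JN + 3)./2.
have a2 : (a.*2 = J0.+1)%N by rewrite /a; lia.
have b2 : (b.*2 = N + JN + 3)%N by rewrite /b; lia.
have thk k : (k%:R <= L0 R N J0 JN + 1) -> th * k%:R < pi.
  move=> kL; case: (posnP k) => [->|k0]; first by rewrite mulr0 pi_gt0.
  have L0' : 0 < L0 R N J0 JN + 1 by apply: lt_le_trans kL; rewrite ltr0n.
  by move: thL; rewrite ltr_pdivlMr// => /(le_lt_trans _); apply; rewrite ler_pM2l.
have La : a%:R <= L0 R N J0 JN + 1.
  have : a%:R *+ 2 = J0%:R + 1 :> R by rewrite natr1 -a2 -mulr_natr -natrM muln2.
  have : J0%:R - 1 <= 2 * L0 R N J0 JN.
    by rewrite /L0 mulrA divff ?pnatr_eq0// mul1r le_max lexx.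
  by lra.
have Lb : (N.+2 - b)%:R <= L0 R N J0 JN + 1.
  have : (N.+2 - b)%:R *+ 2 = N%:R + 1 - JN%:R :> R.
    rewrite natr1 -natrB; last lia.
    by rewrite -mulr_natr -natrM; congr _%:R; lia.
  have : N%:R - 1 - JN%:R <= 2 * L0 R N J0 JN.
    by rewrite /L0 mulrA divff ?pnatr_eq0// mul1r !le_max lexx orbT.
  by lra.
have Lab : (b - a)%:R <= L0 R N J0 JN + 1.
  have : (b - a)%:R *+ 2 = N%:R + JN%:R + 2 - J0%:R :> R.
    rewrite -!natrD -natrB; last lia.
    by rewrite -mulr_natr -natrM; congr _%:R; lia.
  have : N%:R + JN%:R - J0%:R <= 2 * L0 R N J0 JN.
    by rewrite /L0 mulrA divff ?pnatr_eq0// mul1r !le_max lexx !orbT.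
  by lra.
have thpi : 0 < th < pi.
  rewrite th0 -[th]mulr1 (thk 1%N)//; apply: le_trans La.
  by rewrite ler_nat; lia.
have xN := ltn_ord x; have yN := ltn_ord y.
have := @reflected_heat_decays R th N.+2 a b U thpi.
move=> /(_ _ _ _ (thk _ La) (thk _ Lb) (thk _ Lab)).
move=> D; apply: eq_decays (D _ _ _ _ _ _ x.+1 y.+1 _ _); try lia.
- by move=> t; rewrite !UE.
- move=> [|i]// iN t; rewrite /=.
  have iE : (inord i : 'I_N.+1) = i :> nat by rewrite inordK; lia.
  rewrite -{1 2}iE !UE /F iterS markov_op_trans ?iE//; lia.
- by move=> t; rewrite /U /extend /= a2 /= eqSS ifN_eq//; lia.
- move=> t; rewrite /U /extend /= eqxx b2.
  have -> : (N + JN + 3 - N.+2)%N = JN.+1 by lia.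
  by rewrite /= eqSS ifN_eq//; lia.
Qed.

Lemma decays_uniform (R : realType) (r : R) (I : finType) (a : I -> nat -> R) :
  0 < r -> (forall i, decays r (a i)) ->
  exists C, forall i t, `|a i t| <= C * r ^+ t.
Proof.
move=> r0 /choice[C aC]; exists (\sum_i `|C i|) => i t.
apply: (le_trans (aC i t)); rewrite ler_wpM2r ?exprn_ge0 ?(ltW r0)//.
by rewrite (bigD1 i)//= (le_trans (ler_norm _))// lerDl sumr_ge0.
Qed.

Theorem corollary4 (R : realType) (N J0 JN : nat)
    (N_div4 : (4 %| N)%N)
    (J0_odd : odd J0) (J0_ge : (3 <= J0)%N) (J0_le : (J0 + 3 <= N)%N)
    (JN_odd : odd JN) (JN_ge : (3 <= JN)%N) (JN_le : (JN + 3 <= N)%N)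
    (d : measure_display) (T : measurableType d)
    (P : 'I_N.+1 -> probability T R) (X : nat -> T -> 'I_N.+1)
    (X_markov : forall x : 'I_N.+1,
       markov_chain (@trans R N J0 JN) (P x) X x) :
  (limn_esup (fun t : nat => (t%:R^-1)%:E * lne (tv_sup P X t))
     <= (ln (lambda (L0 R N J0 JN)))%:E)%E.
Proof.
set L := L0 R N J0 JN.
have L1 : 2 <= L + 1.
  have : 3%:R <= J0%:R :> R by rewrite ler_nat.
  have : J0%:R - 1 <= 2 * L.
    by rewrite /L /L0 mulrA divff ?pnatr_eq0// mul1r le_max lexx.
  by lra.
have pi0 : 0 < pi :> R := pi_gt0 R.
set th0 := pi / (L + 1).
have th0pi : 0 < th0 < pi.
  rewrite divr_gt0//=; last by lra.
  by rewrite ltr_pdivrMr; [rewrite ltr_pMr//; lra|lra].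
have lim_le th : 0 < th < th0 ->
    (limn_esup (fun t : nat => (t%:R^-1)%:E * lne (tv_sup P X t))
       <= (ln (rate th))%:E)%E.
  move=> thL.
  have r0 : 0 < rate th by apply: rate_gt0; lra.
  have [C dC] := decays_uniform r0 (fun i : {set 'I_N.+1} * ('I_N.+1 * 'I_N.+1) =>
    markov_op_trans_decays (fun y => (y \in i.1)%:R) i.2.1 i.2.2
      (ltac:(lia) : ~~ odd N) J0_odd J0_ge J0_le JN_odd JN_ge JN_le thL).
  apply: limn_esup_lne_le r0 _ => t.
  apply: ub_ereal_sup => _ [[x y] _ <-] /=.
  apply: bigmax_le => [|A _]; first exact: leNye.
  rewrite !(law_markov_op t A (X_markov _)) -EFinB lee_fin.
  exact: le_trans (ler_norm _) (dC (A, (x, y)) t).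
have cv : (ln (rate th))%:E @[th --> th0^'-] --> (ln (rate th0))%:E.
  apply: cvg_EFin; first by near=> th.
  apply: cvg_at_left_filter.
  apply: (@continuous_comp _ _ _ (@rate R) (@ln R)).
    apply: cvgMr; apply: cvgD; [exact: continuous_cos|exact: cvg_cst].
  exact/continuous_ln/rate_gt0.
have -> : lambda L = rate th0 by [].
apply: cvge_to_ge cv _.
near=> th; apply: lim_le; apply/andP; split; near: th.
  by apply: nbhs_left_gt; case/andP: th0pi.
exact: nbhs_left_lt.
Unshelve. all: end_near.
Qed.
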